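(* Let $G$ be a complete multipartite graph. Then every complete expansion $\mathbb{K}[G]$ of $G$ is $k$-indicated colorable for every $k\geq\chi(\mathbb{K}[G])$.
   Context: All graphs are finite, simple and undirected. Indicated coloring game with $k$ colors: each round Ann selects an uncolored vertex and Ben colors it properly with one of the $k$ colors; Ann wins if all vertices get colored, Ben wins if some uncolored vertex has all $k$ colors on its neighbors. A graph is $k$-indicated colorable if Ann has a winning strategy with $k$ colors. For $G$ on vertices $v_1,\dots,v_n$ and positive integers $m_1,\dots,m_n$, the complete expansion $\mathbb{K}[G](m_1,\dots,m_n)$ replaces each $v_i$ by a complete graph $K_{m_i}$ and joins all vertices of the $i$-th and $j$-th copies whenever $v_iv_j\in E(G)$. *)

(* Defs.v *)
From HB Require Import structures.
From mathcomp Require Import all_boot.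

Set Implicit Arguments.
Unset Strict Implicit.
Unset Printing Implicit Defensive.

Record sgraph := SGraph {
  vertex :> finType;
  edge : rel vertex;
  edge_sym : symmetric edge;
  edge_irrefl : irreflexive edge
}.
Arguments edge {s} _ _.

(* The parts are the (nonempty) blocks of P. *)
Definition complete_multipartite (G : sgraph) : Prop :=
  exists2 P : {set {set G}}, partition P [set: G] &
    forall x y : G, edge x y = (pblock P x != pblock P y).

Definition proper (G : sgraph) (k : nat) (f : {ffun G -> 'I_k}) : bool :=
  [forall x, forall y, edge x y ==> (f x != f y)].

Definition colorable (G : sgraph) (k : nat) : bool :=
  [exists f : {ffun G -> 'I_k}, proper f].

Lemma colorable_ex (G : sgraph) : exists k, colorable G k.
Proof.
exists #|G|; apply/existsP; exists [ffun x => enum_rank x].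
apply/forallP => x; apply/forallP => y; apply/implyP => xy.
rewrite !ffunE; apply: contraTneq xy => /enum_rank_inj ->.
by rewrite edge_irrefl.
Qed.

Definition chi (G : sgraph) : nat := ex_minn (colorable_ex G).

Section CompleteExpansion.
Variables (G : sgraph) (m : G -> nat).

Definition expansion_vertex : finType := {v : G & 'I_(m v)}.

Definition expansion_edge : rel expansion_vertex := fun u v =>
  if tag u == tag v then u != v else edge (tag u) (tag v).

Lemma expansion_edge_sym : symmetric expansion_edge.
Proof.
by move=> u v; rewrite /expansion_edge eq_sym (eq_sym u) edge_sym.
Qed.

Lemma expansion_edge_irrefl : irreflexive expansion_edge.
Proof. by move=> u; rewrite /expansion_edge !eqxx. Qed.

Definition complete_expansion : sgraph :=
  SGraph expansion_edge_sym expansion_edge_irrefl.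

End CompleteExpansion.

Section IndicatedColoringGame.
Variables (G : sgraph) (k : nat).

Definition position := {ffun G -> option 'I_k}.

Definition start : position := [ffun=> None].

Definition uncolored (c : position) (v : G) : bool := c v == None.

Definition legal (c : position) (v : G) (a : 'I_k) : bool :=
  uncolored c v && [forall w, edge v w ==> (c w != Some a)].

Definition put (c : position) (v : G) (a : 'I_k) : position :=
  [ffun w => if w == v then Some a else c w].

Definition ben_wins (c : position) : bool :=
  [exists v, uncolored c v &&
    [forall a : 'I_k, exists w, edge v w && (c w == Some a)]].

Definition ann_wins (c : position) : bool := [forall v, ~~ uncolored c v].

(* The list records the rounds in order: the vertex selected by Ann and the
   color chosen by Ben.  The option type allows for "no selection", needed
   once all vertices are colored and when G has no vertex. *)
Definition strategy := seq (G * 'I_k) -> option G.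

(* play s h c: if Ann follows s, then Ben can play so that the history is h,
   which leads to position c. *)
Inductive play (s : strategy) : seq (G * 'I_k) -> position -> Prop :=
| play_start : play s [::] start
| play_round h c v a :
    play s h c -> s h = Some v -> legal c v a ->
    play s (rcons h (v, a)) (put c v a).

(* Every round colors a new vertex, so a play lasts at most #|G| rounds: if
   Ben never wins and Ann always has a selection until every vertex is
   colored, then every play ends with Ann winning. *)
Definition winning (s : strategy) : Prop :=
  forall h c, play s h c ->
    ~~ ben_wins c /\
    (~~ ann_wins c -> exists2 v, s h = Some v & uncolored c v).

Definition indicated_colorable : Prop := exists s : strategy, winning s.

End IndicatedColoringGame.

(* Main.v *)
Require Import Defs.
From mathcomp Require Import all_boot.

Set Implicit Arguments.
Unset Strict Implicit.
Unset Printing Implicit Defensive.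

(** Ann first presents a union M of one largest clique from each part, and then
    the remaining vertices in any order. As M is a clique, it has at most k
    vertices, so while M is not exhausted fewer than k colors are in use and Ben
    cannot win. Once M is colored, the colors on the largest clique of a part
    cannot occur in any other part; hence an uncolored vertex of a clique of
    size s sees at most s - 1 of these at least s colors, and Ben cannot win
    either. *)

Definition colored (G : sgraph) (k : nat) (c : position G k) : {set G} :=
  [set v | ~~ uncolored c v].

(** The condition on [u] excludes edges with both ends uncolored, where both values are [None]; an
    uncolored [v] differs from a colored [u] automatically. *)
Definition partial_proper (G : sgraph) (k : nat) (c : position G k) : Prop :=
  forall u v, edge u v -> u \in colored c -> c u != c v.

Definition clique (G : sgraph) (M : {set G}) : Prop :=
  {in M &, forall u v, u != v -> edge u v}.

Lemma leq_clique_chi (G : sgraph) (M : {set G}) : clique M -> #|M| <= chi G.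
Proof.
move=> cliqueM; rewrite /chi; case: ex_minnP => n /existsP[f f_proper] _.
have inj_f : {in M &, injective f}.
  move=> u v uM vM eq_f; apply/eqP/negPn/negP => neq_uv.
  have /forallP/(_ u)/forallP/(_ v) := f_proper.
  by rewrite (cliqueM _ _ uM vM neq_uv) eq_f eqxx.
by rewrite -(card_in_imset inj_f) -[leqRHS]card_ord max_card.
Qed.

Section PlayInvariants.
Variables (G : sgraph) (k : nat) (s : strategy G k).

Lemma colored_put (c : position G k) v a : colored (put c v a) = v |: colored c.
Proof.
by apply/setP => w; rewrite !inE /uncolored ffunE; case: (w == v).
Qed.

Lemma play_colored h c : play s h c -> colored c = [set v in unzip1 h].
Proof.
elim=> [|{}h {}c v a _ IH _ _].
  by apply/setP => v; rewrite !inE /uncolored ffunE.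
rewrite colored_put IH; apply/setP => w.
by rewrite !inE /unzip1 map_rcons mem_rcons inE.
Qed.

Lemma play_proper h c : play s h c -> partial_proper c.
Proof.
elim=> [|{}h {}c v a _ IH _ /andP[_ /forallP legal_a]] u w uw.
  by rewrite !inE /uncolored ffunE.
have Nuv x : edge v x -> c x != Some a by move: (legal_a x) => /implyP.
rewrite colored_put !inE !ffunE.
case: (eqVneq u v) uw => [->|neq_uv] uw.
  case: (eqVneq w v) uw => [->|_ /Nuv]; first by rewrite edge_irrefl.
  by rewrite eq_sym.
case: (eqVneq w v) uw => [->|_] uw col_u; first by apply: Nuv; rewrite edge_sym.
by apply: IH; rewrite // inE.
Qed.

End PlayInvariants.

(** A blocked vertex sees every color on some colored neighbor, and different colors sit on
    different vertices. *)
Lemma ben_wins_colored (G : sgraph) (k : nat) (c : position G k) :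
  ben_wins c -> k <= #|colored c|.
Proof.
case/existsP=> v /andP[_ /forallP all_colors].
rewrite -[leqLHS]card_ord -cardsT -(card_imset _ Some_inj).
apply: leq_trans (leq_imset_card c _); apply/subset_leq_card/subsetP => x.
case/imsetP=> a _ ->; have /existsP[w /andP[_ /eqP cw]] := all_colors a.
by apply/imsetP; exists w; rewrite // inE /uncolored cw.
Qed.

(** Removes the game: what remains to check is a static condition on partial proper colorings that
    cover [M]. *)
Lemma indicated_colorable_first (G : sgraph) (k : nat) (M : {set G}) :
    #|M| <= k ->
    (forall c : position G k,
       partial_proper c -> M \subset colored c -> ~~ ben_wins c) ->
  indicated_colorable G k.
Proof.
move=> leMk M_safe.
(* A strategy sees only the history, so uncolored means absent from [unzip1 h]. *)
pose s (h : seq (G * 'I_k)) :=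
  if [pick v in M | v \notin unzip1 h] is Some v then Some v
  else [pick v | v \notin unzip1 h].
have s_order h c : play s h c -> M \subset colored c \/ colored c \subset M.
  elim=> [|{}h {}c v a pl IH + _].
    by right; apply/subsetP => v; rewrite inE /uncolored ffunE.
  rewrite /s colored_put; case: pickP => [w /andP[wM wh] [<-]|noM _].
    right; rewrite subUset sub1set wM /=; case: IH => // /subsetP/(_ w wM).
    by rewrite (play_colored pl) inE (negPf wh).
  left; apply/subsetP => w wM; rewrite inE (play_colored pl) !inE.
  by have /= := noM w; rewrite wM => /negbFE ->; rewrite orbT.
exists s => h c pl; split.
  have [Mc|nMc] := boolP (M \subset colored c).
    exact: M_safe (play_proper pl) Mc.
  have [Mc|cM] := s_order _ _ pl; first by rewrite Mc in nMc.
  (* A win of Ben takes [k] colored vertices; as they all lie in [M] and [#|M| <= k], they would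
     exhaust [M]. *)
  apply: contra nMc => /ben_wins_colored le_k.
  by have /eqP-> : colored c == M by rewrite eqEcard cM (leq_trans leMk).
have uncE v : uncolored c v = (v \notin unzip1 h).
  by have /setP/(_ v) := play_colored pl; rewrite !inE => <-; rewrite negbK.
case/forallPn=> v; rewrite negbK uncE => v_h; rewrite /s.
case: pickP => [w /andP[_ wh]|_]; first by exists w; rewrite ?uncE.
by case: pickP => [w wh|/(_ v)]; [exists w; rewrite ?uncE | rewrite v_h].
Qed.

(* The fibers of p play the role of the parts. *)
Lemma max_weight_transversal (V : finType) (T : eqType) (p : V -> T)
    (m : V -> nat) :
  exists R : {set V}, {in R &, injective p} /\
    forall x, exists y, [/\ y \in R, p y = p x & m x <= m y].
Proof.
pose heaviest t := [pick y |
  (p y == t) && [forall z, (p z == t) ==> (m z <= m y)]].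
(* [heaviest] depends only on the value of [p], so each fiber contributes at most one vertex. *)
exists [set y | heaviest (p y) == Some y]; split.
  by move=> x y; rewrite !inE => /eqP + /eqP + eq_p; rewrite eq_p => -> [].
move=> x; case def_y: (heaviest (p x)) => [y|].
  move: (def_y); rewrite /heaviest; case: pickP => // _ /[swap] -[->].
  case/andP=> /eqP py /forallP/(_ x); rewrite eqxx /= => le_xy.
  by exists y; split; rewrite // inE py -/(heaviest _) def_y.
move: def_y; rewrite /heaviest; case: pickP => // none _.
have [//|y /eqP py y_max] := @arg_maxnP _ x (fun y => p y == p x) m.
move: (none y); rewrite py eqxx => /forallP[] z.
by apply/implyP => /y_max.
Qed.

Section Fiber.
Variables (G : sgraph) (m : G -> nat).

Definition fiber (x : G) : {set complete_expansion m} := [set u | tag u == x].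

Lemma card_fiber x : #|fiber x| = m x.
Proof.
pose f (i : 'I_(m x)) : complete_expansion m := Tagged (fun v => 'I_(m v)) i.
have inj_f : injective f.
  by move=> i j /eqP; rewrite -tag_eqE /tag_eq eqxx tagged_asE => /eqP.
rewrite -[RHS]card_ord -cardsT -(card_imset _ inj_f).
congr #|pred_of_set _|; apply/setP => u; rewrite inE; apply/eqP/imsetP.
  by case: u => y i /= eq_y; subst y; exists i.
by case=> i _ ->.
Qed.

Lemma edge_fiber (u v : complete_expansion m) :
  tag u = tag v -> edge u v = (u != v).
Proof. by move=> eq_t; rewrite /edge /= /expansion_edge eq_t eqxx. Qed.

Lemma edge_tag (u v : complete_expansion m) :
  edge (tag u) (tag v) -> edge u v.
Proof.
rewrite {2}/edge /= /expansion_edge; case: eqP => // ->.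
by rewrite edge_irrefl.
Qed.

Lemma edge_nontag (u v : complete_expansion m) :
  edge u v -> ~~ edge (tag u) (tag v) -> tag u = tag v.
Proof. by rewrite {1}/edge /= /expansion_edge; case: eqP => // _ ->. Qed.

End Fiber.

Theorem theorem3p17 (G : sgraph) (hG : complete_multipartite G)
    (m : G -> nat) (hm : forall v : G, 0 < m v)
    (k : nat) (hk : chi (complete_expansion m) <= k) :
  indicated_colorable (complete_expansion m) k.
Proof.
case: hG => P _ edgeE.
(* Above a part, the expansion is a disjoint union of the cliques [fiber x], so a largest clique
   there lies over a vertex with maximal [m]. *)
have [R [injR R_max]] := @max_weight_transversal G _ (pblock P) m.
pose M : {set complete_expansion m} := [set u | tag u \in R].
apply: (@indicated_colorable_first _ k M).
  apply: leq_trans hk; apply: leq_clique_chi => u v.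
  rewrite !inE => uR vR neq_uv.
  have [eq_t|neq_t] := eqVneq (tag u) (tag v); first by rewrite edge_fiber.
  by apply: edge_tag; rewrite edgeE (inj_in_eq injR).
move=> c c_proper /subsetP Mc; apply/existsP => -[v /andP[unc_v /forallP all_v]].
have [y [yR py le_vy]] := R_max (tag v).
have y_col u : u \in fiber m y -> u \in colored c.
  by rewrite inE => /eqP tu; apply: Mc; rewrite inE tu.
have inj_c : {in fiber m y &, injective c}.
  move=> u w uy wy eq_c; apply/eqP/negPn/negP => neq_uw.
  have := c_proper u w; rewrite eq_c eqxx y_col // edge_fiber //.
    by move=> /(_ neq_uw isT).
  by move: uy wy; rewrite !inE => /eqP-> /eqP->.
(* The [m y] distinct colors on [fiber m y] will all be found on the fiber of [v] with [v] itself
   removed. *)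
suff: m y < m (tag v) by rewrite ltnNge le_vy.
rewrite -[X in X < _]card_fiber -[X in _ < X]card_fiber -(card_in_imset inj_c).
rewrite [X in _ < X](cardsD1 v) inE eqxx ltnS.
apply: leq_trans (leq_imset_card c _); apply/subset_leq_card/subsetP => x.
case/imsetP=> u uy ->; have := y_col u uy.
rewrite inE /uncolored; case cu: (c u) => [a|] // _.
have /existsP[w /andP[vw /eqP cw]] := all_v a.
apply/imsetP; exists w => //; rewrite !inE.
have -> : w != v by apply: contraTneq vw => ->; rewrite edge_irrefl.
(* If [w] lay over another part, it would also be adjacent to [u], which lies over the same part as
   [v] and has the same color as [w]. *)
rewrite [tag w == _]eq_sym; apply/eqP/edge_nontag => //; apply/negP => t_vw.
have uw : edge u w.
  apply: edge_tag; move: uy; rewrite inE => /eqP->.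
  by rewrite edgeE py -edgeE.
by have := c_proper _ _ uw (y_col u uy); rewrite cu cw eqxx.
Qed.
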